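(* If $p \equiv 1 \pmod 4$ is prime and $4$ divides the multiplicative order of $k$ in $\mathbb{Z}_p^*$, then there is a factorisation of $K_p$ into $\mathrm{Cay}(\mathbb{Z}_p; \pm\{1, k\})$.
   Context: For a group $G$ and a subset $S \subseteq G$ not containing the identity and closed under inverses, the Cayley graph $\mathrm{Cay}(G;S)$ has vertex set $G$, with $g$ adjacent to $g s$ for each $g\in G$, $s \in S$. $\pm\{a_1,\dots,a_s\}$ denotes $\{\pm a_1,\dots,\pm a_s\}$. A factorisation of a graph into $H$ is a decomposition of its edge set into edge-disjoint spanning subgraphs each isomorphic to $H$. $\mathbb{Z}_p^*$ is the multiplicative group of units modulo $p$. *)

(* Defs.v *)
From HB Require Import structures.
From mathcomp Require Import all_boot all_order all_algebra all_fingroup.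

Set Implicit Arguments.
Unset Strict Implicit.
Unset Printing Implicit Defensive.

Import GRing.Theory FinRing.Theory.
Local Open Scope ring_scope.

Definition simple_graph (T : finType) (e : rel T) : Prop :=
  symmetric e /\ irreflexive e.

Definition complete_graph (n : nat) : rel 'I_n := fun x y => x != y.
Arguments complete_graph n : clear implicits.

Definition graph_iso (T U : finType) (e : rel T) (h : rel U) : Prop :=
  exists2 f : T -> U, bijective f & forall x y, e x y = h (f x) (f y).

(* All F i live on the whole vertex type T of e, so they are spanning. *)
Definition is_factorisation (T U : finType) (e : rel T) (h : rel U)
    (m : nat) (F : 'I_m -> rel T) : Prop :=
  [/\ forall i, simple_graph (F i),
      forall i, subrel (F i) e,
      forall x y, e x y -> exists! i, F i x y
    & forall i, graph_iso (F i) h].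

Definition has_factorisation (T U : finType) (e : rel T) (h : rel U) : Prop :=
  exists m (F : 'I_m -> rel T), is_factorisation e h F.

(* A simple graph only when 1 \notin S and S is closed under inverses,
   see cayley_simple. *)
Definition cayley (gT : finGroupType) (S : {set gT}) : rel gT :=
  fun g h => [exists s in S, h == (g * s)%g].

Lemma cayley_simple (gT : finGroupType) (S : {set gT}) :
  (1%g \notin S) -> (forall s, s \in S -> (s^-1)%g \in S) ->
  simple_graph (cayley S).
Proof.
move=> S1 SV.
have half g h : cayley S g h -> cayley S h g.
  case/exists_inP=> s sS /eqP->; apply/exists_inP.
  by exists (s^-1)%g; [exact: SV | rewrite mulgK].
split=> [g h | g]; first by apply/idP/idP; apply: half.
apply/negbTE/exists_inP => -[s sS]; rewrite -{1}[g]mulg1.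
by move/eqP/mulgI => s1; rewrite s1 sS in S1.
Qed.

Definition pm (V : finZmodType) (A : {set V}) : {set V} :=
  A :|: [set - a | a in A].

Lemma pm_units_simple (p : nat) (k : {unit 'Z_p}) :
  simple_graph (cayley (pm [set 1; val k])).
Proof.
have nz_k : val k != 0.
  by apply: contraTneq (valP k) => ->; rewrite unitr0.
apply: cayley_simple => [|s].
  rewrite !inE negb_or; apply/andP; split.
    by rewrite negb_or ![_ == (1 : 'Z_p)]eq_sym ![_ == val k]eq_sym oner_neq0.
  apply/imsetP => -[a]; rewrite !inE => /orP[]/eqP-> /eqP;
    by rewrite eq_sym oppr_eq0 ?oner_eq0 ?(negPf nz_k).
case/setUP=> [sA | /imsetP[a aA ->]]; apply/setUP.
  by right; apply/imsetP; exists s.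
by left; rewrite zmodVgE opprK.
Qed.

(* Main.v *)
(** Writing S = {1, -1, k, -k}, it suffices to find a set X of units such that
    every unit is uniquely x * s with x in X and s in S: the factors are then
    the Cayley graphs with connection sets x * S, each isomorphic to the one
    for S through multiplication by x. Since 4 divides the order of k, the
    unique involution -1 is a power of k^2 and <k^2> has index two in <k>.
    Hence the units split into two classes exchanged by k and preserved by -1,
    and X consists of one unit out of each pair {g, -g} in the first class. *)

Require Import Defs.
From mathcomp Require Import all_boot all_order all_algebra all_fingroup.
From mathcomp Require Import cyclic.

Set Implicit Arguments.
Unset Strict Implicit.
Unset Printing Implicit Defensive.

Import GRing.Theory FinRing.Theory.
Local Open Scope ring_scope.

Section Tiling.

Variables (gT : finGroupType) (k z : gT).
Hypothesis mulgC : commutative (@mulg gT).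
Local Open Scope group_scope.

(** Only the parity of the exponent of [h] as a power of [k] matters: [<[k ^+ 2]>] has index two in
    [<[k]>], and [k] swaps its two cosets. *)
Lemma mem_cycle_sqr (h : gT) : k \notin <[k ^+ 2]> -> h \in <[k]> ->
  (k * h \in <[k ^+ 2]>) = (h \notin <[k ^+ 2]>).
Proof.
move=> kN /cycleP[n ->]; rewrite -[n]odd_double_half expgD -muln2 mulnC expgM.
have e2 : (k ^+ 2) ^+ n./2 \in <[k ^+ 2]> by rewrite mem_cycle.
case: (odd n); last by rewrite expg0 mul1g groupMr // e2 (negPf kN).
by rewrite expg1 mulgA !(groupMr _ e2) kN -[k * k]/(k ^+ 2) cycle_id.
Qed.

(* The parity of the exponent of k in g = k ^+ n * r, where r is the chosen
   representative of the coset of g. *)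
Definition even_part (g : gT) : bool :=
  g * (repr (<[k]> :* g))^-1 \in <[k ^+ 2]>.

(** Multiplying by an element of [<[k]>] keeps the coset, hence its representative. *)
Lemma even_part_cycle (h g : gT) : h \in <[k]> ->
  even_part (h * g) = (h * (g * (repr (<[k]> :* g))^-1) \in <[k ^+ 2]>).
Proof. by move=> hk; rewrite /even_part rcosetM rcoset_id // mulgA. Qed.

Lemma even_partMk (g : gT) : k \notin <[k ^+ 2]> ->
  even_part (k * g) = ~~ even_part g.
Proof.
move=> kN; rewrite even_part_cycle ?cycle_id // mem_cycle_sqr //.
by rewrite -mem_rcoset (rcoset_eqP (mem_repr_rcoset _ g)) rcoset_refl.
Qed.

Lemma even_partMz (g : gT) : z \in <[k ^+ 2]> -> even_part (z * g) = even_part g.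
Proof.
move=> zk; rewrite even_part_cycle; first by rewrite groupMl.
by apply: subsetP zk; rewrite cycle_subG mem_cycle.
Qed.

(** When [z] is an involution, its cosets are the pairs [g], [z * g]; [repr] selects one element of
    each. *)
Definition tile_centres : {set gT} :=
  [set g | even_part g && (repr (<[z]> :* g) == g)].

Lemma tile_centre_pair (g : gT) : z ^+ 2 = 1 -> z \in <[k ^+ 2]> ->
  even_part g -> exists2 x, x \in tile_centres & x = g \/ x = z * g.
Proof.
move=> z2 zk eg; exists (repr (<[z]> :* g)).
  have /rcosetP[_ /cycleP[n ->] e] := mem_repr_rcoset [group of <[z]>] g.
  rewrite inE (rcoset_eqP (mem_repr_rcoset [group of <[z]>] g)) eqxx andbT.
  rewrite e; elim: n {e} => [|n IHn]; first by rewrite mul1g.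
  by rewrite expgS -mulgA even_partMz.
have /rcosetP[_ /cycleP[n ->] ->] := mem_repr_rcoset [group of <[z]>] g.
rewrite -[n]odd_double_half expgD -muln2 mulnC expgM z2 expg1n mulg1.
by case: (odd n); [right | left; rewrite mul1g].
Qed.

(** Both elements lie in one coset of [<[z]>], which has a single representative. *)
Lemma tile_centreMz (g : gT) : z != 1 -> g \in tile_centres ->
  z * g \notin tile_centres.
Proof.
rewrite !inE rcosetM (rcoset_id (cycle_id z)) => z1 /andP[_ /eqP->].
apply: contraNN z1 => /andP[_ /eqP e].
by apply/eqP/(mulIg g); rewrite mul1g -e.
Qed.

(** The candidates for [x] are [g], [z * g], [k^-1 * g] and [z * (k^-1 * g)]. They form two pairs
    under [z]; exactly one pair is even, and [tile_centres] meets it once. *)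
Lemma exists_unique_tile (g : gT) :
    k \notin <[k ^+ 2]> -> z \in <[k ^+ 2]> -> z ^+ 2 = 1 -> z != 1 ->
  exists! x, x \in tile_centres /\ x^-1 * g \in [set 1; z; k; z * k].
Proof.
move=> kN zk z2 z1.
have zV : z^-1 = z by apply/eqP; rewrite eq_sym eq_mulgV1 invgK -z2.
(* [c] is [1] if [g] is even and [k] otherwise, so that [c^-1 * g] generates the even pair. *)
have [c [c1 cg]] : exists c, even_part (c^-1 * g) /\
    forall x, even_part x ->
      (x^-1 * g \in [set 1; z; k; z * k]) =
      (x == c^-1 * g) || (x == z * (c^-1 * g)).
  have sol x s : (x^-1 * g == s) = (x == s^-1 * g).
    rewrite -(inj_eq (mulgI x)) mulKVg -[RHS](inj_eq (mulgI s)) mulKVg.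
    by rewrite eq_sym (mulgC s).
  have ek x : even_part (k^-1 * x) = ~~ even_part x.
    by rewrite -[in RHS](mulKVg k x) even_partMk ?negbK.
  have mem x : (x^-1 * g \in [set 1; z; k; z * k]) =
      [|| x == g, x == z * g, x == k^-1 * g | x == z * (k^-1 * g)].
    rewrite !inE !sol invg1 mul1g invMg zV (mulgC k^-1 z) -!mulgA.
    by rewrite -!orbA.
  have [eg|eg] := boolP (even_part g).
    exists 1; rewrite invg1 mul1g; split=> // x ex; rewrite mem.
    have nk : x == k^-1 * g = false.
      by apply: contraTF ex => /eqP->; rewrite ek negbK.
    have nzk : x == z * (k^-1 * g) = false.
      by apply: contraTF ex => /eqP->; rewrite even_partMz ?ek ?negbK.
    by rewrite nk nzk !orbF.
  exists k; rewrite ek; split=> // x ex; rewrite mem.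
  have n1 : x == g = false by apply: contraTF ex => /eqP->.
  have nz : x == z * g = false.
    by apply: contraTF ex => /eqP->; rewrite even_partMz.
  by rewrite n1 nz.
have even x : x \in tile_centres -> even_part x by rewrite inE => /andP[].
have [x xX xE] := tile_centre_pair z2 zk c1.
exists x; split=> [|y [yX]].
  by split; rewrite // cg ?even //; case: xE => ->; rewrite eqxx ?orbT.
rewrite cg ?even // => yE.
have zz h : z * (z * h) = h by rewrite mulgA -[z * z]/(z ^+ 2) z2 mul1g.
have [-> //|yzx] : y = x \/ y = z * x.
  by case/orP: yE => /eqP->; case: xE => ->; rewrite ?zz; auto.
by have := tile_centreMz z1 xX; rewrite -yzx yX.
Qed.

End Tiling.

(** Each factor is [h] pulled back along [f i], so [f i] itself is the isomorphism; [enum_val]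
    indexes [X] by ordinals. *)
Lemma pullback_factorisation (n : nat) (U I : finType) (h : rel U)
    (X : {set I}) (f : I -> 'I_n -> U) :
    simple_graph h -> (forall i, bijective (f i)) ->
    (forall x y, x != y -> exists! i, i \in X /\ h (f i x) (f i y)) ->
  has_factorisation (complete_graph n) h.
Proof.
move=> [hsym hirr] fbij funiq.
exists #|X|, (fun i x y => h (f (enum_val i) x) (f (enum_val i) y)).
split=> [i|i x y|x y xy|i].
- by split=> [x y|x]; rewrite ?hirr // hsym.
- by apply: contraTneq => ->; rewrite hirr.
- have [j [[jX hj] j_uniq]] := funiq x y xy.
  exists (enum_rank_in jX j); split; first by rewrite enum_rankK_in.
  move=> i hi; apply: enum_val_inj; rewrite enum_rankK_in //.
  by apply: j_uniq; split=> //; apply: enum_valP.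
- by exists (f (enum_val i)).
Qed.

Lemma Zp_nonzero_unit (p : nat) (x : 'Z_p) :
  prime p -> x != 0 -> x \is a GRing.unit.
Proof.
move=> pr_p nz_x; have p1 := prime_gt1 pr_p.
rewrite -[x]natr_Zp unitZpE // prime_coprime // gtnNdvd //.
  by rewrite lt0n.
by rewrite -[X in (_ < X)%N]Zp_cast.
Qed.

(** The product of [z - 1] and [z + 1] vanishes, and [z - 1] is nonzero, hence a unit modulo a
    prime. *)
Lemma Zp_unit_involution (p : nat) (z : {unit 'Z_p}) :
  prime p -> (z ^+ 2 = 1)%g -> z != 1%g -> val z = -1.
Proof.
move=> pr_p /(congr1 val); rewrite val_unitX val_unit1 => /eqP.
rewrite -subr_eq0 subr_sqr_1 => /eqP zz z1.
have u : val z - 1 \is a GRing.unit.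
  by apply: Zp_nonzero_unit => //; rewrite subr_eq0 -val_unit1 val_eqE.
by apply/eqP; rewrite -subr_eq0 opprK -(mulrI_eq0 _ (mulrI u)) zz.
Qed.

Lemma cayley_pmE (p : nat) (k a b : 'Z_p) :
  cayley (pm [set 1; k]) a b =
    [|| b - a == 1, b - a == -1, b - a == k | b - a == - k].
Proof.
have -> : cayley (pm [set 1; k]) a b = (b - a \in pm [set 1; k]).
  apply/exists_inP/idP => [[s sS /eqP->]|bS].
    by rewrite zmodMgE addrC addKr.
  by exists (b - a); rewrite // zmodMgE addrC subrK.
rewrite /pm imsetU1 imset_set1 !inE -!orbA.
by congr (_ || _); rewrite orbCA.
Qed.

Theorem theorem2 (p : nat) (k : {unit 'Z_p}) :
  prime p -> (p = 1 %[mod 4])%N -> (4 %| #[k]%g)%N ->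
  has_factorisation (complete_graph p) (cayley (pm [set 1; val k])).
Proof.
move=> pr_p _ /dvdnP[m ordk].
(* With the modulus in the form [p.+2], ['Z_p.+2] and ['I_p.+2] are convertible, so the vertices are
   residues. *)
case: p k pr_p ordk => [|[|p]] k // pr_p ordk.
have m_gt0 : (0 < m)%N by have := order_gt0 k; rewrite ordk muln_gt0 => /andP[].
(* As [k] has order [4m], this power has order two, and its even exponent puts it in
   [<[k ^+ 2]>]. *)
pose z := (k ^+ (2 * m))%g.
have z2 : (z ^+ 2 = 1)%g by rewrite -expgM mulnAC mulnC -ordk expg_order.
have z1 : z != 1%g.
  by rewrite -order_dvdn ordk gtnNdvd ?muln_gt0 // mulnC ltn_pmul2l.
have zk : z \in <[(k ^+ 2)%g]>%g by rewrite /z expgM mem_cycle.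
have kN : k \notin <[(k ^+ 2)%g]>%g.
  (* Otherwise [<[k]>], of order [4m], would be contained in [<[k ^+ 2]>], of order [2m]. *)
  apply/negP; rewrite -cycle_subG => /subset_leq_card.
  rewrite -!orderE orderXdiv ordk -[4%N]/(2 * 2)%N mulnA ?dvdn_mull // mulnK //.
  by rewrite leqNgt ltn_Pmulr // muln_gt0 m_gt0.
have zE := Zp_unit_involution pr_p z2 z1.
(* Pulling back along multiplication by the inverse of [x] gives the Cayley graph of [x * S]. *)
apply: (@pullback_factorisation _ _ _ _ (tile_centres k z)
  (fun (x : {unit 'Z_p.+2}) (a : 'Z_p.+2) => val x^-1%g * a)) => [|x|a b ab].
- exact: pm_units_simple.
- exists (fun a : 'Z_p.+2 => val x * a) => a.
    by rewrite val_unitV mulVKr //; apply: valP.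
  by rewrite val_unitV mulKr //; apply: valP.
(* The edge from [a] to [b] lies in the factor of [x] exactly when the unit [b - a] lies in the tile
   [x * S]. *)
have uba : (b - a : 'Z_p.+2) \is a GRing.unit.
  by apply: Zp_nonzero_unit => //; rewrite subr_eq0 eq_sym.
pose g : {unit 'Z_p.+2} := FinRing.unit _ uba.
have tileE (x : {unit 'Z_p.+2}) :
    cayley (pm [set 1; val k]) (val x^-1%g * a) (val x^-1%g * b) =
    (x^-1 * g \in [set 1; z; k; z * k])%g.
  rewrite cayley_pmE -mulrBr !inE -!val_eqE !val_unitM val_unit1 zE mulN1r.
  by rewrite -!orbA.
have [x [[xX xg] x_uniq]] :=
  exists_unique_tile (@unit_Zp_mulgC _) g kN zk z2 z1.
exists x; split=> [|y [yX]]; first by rewrite tileE.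
by rewrite tileE => yg; apply: x_uniq.
Qed.
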